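(* Let $K$ be a field, $\Delta$ a simplicial complex on $[n]$ and $F$ a good leaf of $\Delta$. Let $\Gamma$ be the subcomplex obtained from $\Delta$ by removing $F$, i.e. the simplicial complex whose set of facets is $\mathcal{F}(\Delta)\setminus\{F\}$. Then $$d(A(\Delta))=d(A(\Gamma)).$$
   Context: $\mathbb{N}=\{0,1,2,\ldots\}$ and $[n]=\{1,\ldots,n\}$. A simplicial complex on $[n]$ is a collection of subsets of $[n]$ (faces) closed under taking subsets; its maximal faces are its facets, and $\mathcal{F}(\Delta)$ is the set of facets. Facets are nonempty. A subcomplex of $\Delta$ means a simplicial complex all of whose facets are facets of $\Delta$. A facet $F$ of $\Delta$ is a leaf if either $F$ is the only facet of $\Delta$, or there exists $G\in\mathcal{F}(\Delta)$, $G\ne F$, such that $H\cap F\subseteq G\cap F$ for each $H\in\mathcal{F}(\Delta)$ with $H\ne F$. A leaf $F$ of $\Delta$ is a good leaf if $F$ is a leaf of each subcomplex of $\Delta$ to which it belongs (as a facet); equivalently, the collection of sets $F\cap G$ with $G\in\mathcal{F}(\Delta)$ is totally ordered by inclusion. For $k\ge 0$, a vector $\mathbf{c}=(c_1,\ldots,c_n)\in\mathbb{N}^n$ is a $k$-cover of $\Delta$ if $\sum_{i\in F}c_i\ge k$ for all $F\in\mathcal{F}(\Delta)$. Let $S=K[x_1,\ldots,x_n]$, let $t$ be a new variable, and let $A_k(\Delta)$ be the $K$-span of all monomials $x_1^{c_1}\cdots x_n^{c_n}t^k$ with $(c_1,\ldots,c_n)$ a $k$-cover of $\Delta$. The vertex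 cover algebra is the graded $S$-algebra $A(\Delta)=\bigoplus_{k\ge 0}A_k(\Delta)\subseteq S[t]$ (so $A_0(\Delta)=S$); it is a finitely generated $S$-algebra. (If $\Gamma$ has no facets then, by this definition, $A(\Gamma)=S[t]$.) $d(A(\Delta))$ denotes the maximal $t$-degree of an element in a minimal homogeneous system of generators of the $S$-algebra $A(\Delta)$. *)

(* Defs.v *)
From HB Require Import structures.
From mathcomp Require Import all_boot all_order all_algebra.
From mathcomp Require Import boolp classical_sets.
From mathcomp Require Import mpoly.
Set Implicit Arguments.
Unset Strict Implicit.
Unset Printing Implicit Defensive.

Import GRing.Theory.
Local Open Scope ring_scope.

Record simplicial_complex (n : nat) := SimplicialComplex {
  faces :> {set {set 'I_n}};
  faces_closed : forall G H : {set 'I_n}, H \in faces -> G \subset H -> G \in faces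
}.

Definition facets n (D : simplicial_complex n) : {set {set 'I_n}} :=
  [set G in faces D | [forall H in faces D, (G \subset H) ==> (H == G)]].

Definition leaf n (D : simplicial_complex n) (F : {set 'I_n}) : Prop :=
  F \in facets D /\
  (facets D = [set F] \/
   exists G, [/\ G \in facets D, G != F &
     forall H, H \in facets D -> H != F -> H :&: F \subset G :&: F]).

Definition good_leaf n (D : simplicial_complex n) (F : {set 'I_n}) : Prop :=
  leaf D F /\
  forall D' : simplicial_complex n,
    facets D' \subset facets D -> F \in facets D' -> leaf D' F.

Definition kcover n (D : simplicial_complex n) (k : nat) (c : 'X_{1..n}) : Prop :=
  forall G : {set 'I_n}, G \in facets D -> (k <= \sum_(i in G) c i)%N.

(* S[t] is {poly {mpoly K[n]}}, so 'X is t and the constants p%:P are S. *)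
Section VertexCoverAlgebra.
Local Open Scope classical_set_scope.
Variables (K : fieldType) (n : nat).
Local Notation S := {mpoly K[n]}.
Implicit Types (A G : set {poly S}) (f g : {poly S}).

Definition cover_component (D : simplicial_complex n) (k : nat) : set {poly S} :=
  [set f | exists (s : seq 'X_{1..n}) (a : 'X_{1..n} -> K),
     (forall c, c \in s -> kcover D k c) /\
     f = \sum_(c <- s) (a c *: 'X_[c]) *: 'X^k].

Definition cover_algebra (D : simplicial_complex n) : set {poly S} :=
  [set f | forall k, cover_component D k (f`_k *: 'X^k)].

Inductive subalgebra G : set {poly S} :=
| subalgebra_gen g of G g : subalgebra G g
| subalgebra_const (p : S) : subalgebra G p%:P
| subalgebra_add f g of subalgebra G f & subalgebra G g : subalgebra G (f + g)
| subalgebra_mul f g of subalgebra G f & subalgebra G g : subalgebra G (f * g).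

Definition homogeneous f : Prop := exists (p : S) (k : nat), f = p *: 'X^k.

Definition minimal_homogeneous_generators A G : Prop :=
  [/\ forall g, G g -> homogeneous g, subalgebra G = A &
      forall G', G' `<=` G -> subalgebra G' = A -> G' = G].

Definition tdegree f : nat := (size f).-1.

(* All choices of a minimal homogeneous system give the same value when A is
   graded with A_0 = S (it is determined by A_+ / A_+^2); the default 0 is only
   used when no such system has a largest t-degree, e.g. when A = S. *)
Definition max_generator_degree A : nat :=
  xget 0%N [set d | exists G, [/\ minimal_homogeneous_generators A G,
    exists2 g, G g & tdegree g = d & forall g, G g -> (tdegree g <= d)%N]].

End VertexCoverAlgebra.

Arguments cover_component : clear implicits.
Arguments cover_algebra : clear implicits.

(* Main.v *)
Require Import Defs.
From mathcomp Require Import all_boot all_order all_algebra.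
From mathcomp Require Import boolp classical_sets.
From mathcomp Require Import mpoly.

(** A new generator of the cover algebra [A(D)] is needed in degree [k > 0]
    exactly when some [k]-cover is not a sum of an [i]-cover and a [j]-cover
    with [i + j = k] and [i, j > 0]; such a [k] is called a generator degree.
    So it suffices that a complex and its deletion of a good leaf [F] have the
    same generator degrees ([generator_degree_remove_leaf]).

    If a [k]-cover [c] of [Delta] splits as [a + b] over [Gamma], the splitting
    can be repaired so as to cover [F] too. Since [c] has weight at least
    [i + j] on [F], a deficit of one summand on [F] is an excess of the other,
    say [b].  Because [F] is a good leaf, the sets [F :&: G] form a chain.
    Take a vertex [v] of [F] in the support of [b] lying in as few facets as
    possible: every facet [G] through [v] contains the whole support of [b] in
    [F], so [b] has excess weight on [G] as well, and one unit at [v] can be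
    moved from [b] to [a] ([transfer_vertex], [rebalance]).  Conversely a leaf
    has a vertex [v] that lies in no other facet; increasing a cover of [Gamma]
    by [k] at [v] makes it a cover of [Delta], and the values at [v] in a
    splitting of the result are irrelevant over [Gamma].

    On the algebraic side, [cover_algebraE] describes the cover algebra by the
    monomials that may occur.  The polynomials whose monomials lie in a monoid
    of exponents containing all those of degree zero form a subalgebra
    ([subalgebra_supported]); applied to the monoid obtained by discarding
    indecomposable exponents, this shows that a generating set cannot avoid
    them.  Hence every minimal homogeneous generating set has generators
    precisely in the generator degrees ([generator_degree_in_generators],
    [minimal_generator_degree]), and such a set exists, given by the irreducible
    elements of the monoid of covers ([irreducible_monomials_minimal]). *)

Set Implicit Arguments.
Unset Strict Implicit.
Unset Printing Implicit Defensive.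
Import GRing.Theory.

(** * Leaves of simplicial complexes *)

Section Complexes.
Variable n : nat.
Implicit Types (D : simplicial_complex n) (F G H : {set 'I_n}) (a b c : 'X_{1..n}).

Lemma facet_maximal D G H :
  G \in facets D -> H \in facets D -> G \subset H -> G = H.
Proof.
rewrite !inE => /andP[_ /forallP/(_ H)]/implyP maxG /andP[DH _] sGH.
by move/implyP: (maxG DH) => /(_ sGH)/eqP.
Qed.

(** Facets form an antichain, so the complex generated by some of them has
    precisely these as its facets. *)
Lemma facets_generate D (E : {set {set 'I_n}}) :
  E \subset facets D -> exists D', facets D' = E.
Proof.
move=> /fintype.subsetP sED.
pose fs := [set A : {set 'I_n} | [exists B in E, A \subset B]]%SET.
have fsP (A B : {set 'I_n}) : B \in fs -> A \subset B -> A \in fs.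
  rewrite !inE => /exists_inP[C EC sBC] sAB.
  by apply/exists_inP; exists C => //; apply: fintype.subset_trans sBC.
have sEfs (A : {set 'I_n}) : A \in E -> A \in fs.
  by move=> EA; rewrite inE; apply/exists_inP; exists A.
exists (SimplicialComplex fsP); apply/setP => A; rewrite !inE /=.
apply/andP/idP => [[/exists_inP[B EB sAB] /forallP/(_ B)/implyP]|EA].
  by move=> /(_ (sEfs _ EB))/implyP/(_ sAB)/eqP <-.
split; first by have:= sEfs _ EA; rewrite inE.
apply/forallP => B; apply/implyP; rewrite inE => /exists_inP[C EC sBC].
apply/implyP => sAB; rewrite finset.eqEsubset sAB andbT.
by rewrite (facet_maximal (sED _ EA) (sED _ EC) (fintype.subset_trans sAB sBC)).
Qed.

(** [F] is a leaf of the subcomplex with facets [F], [G], [H], and the facet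
    witnessing it is [G] or [H]. *)
Lemma good_leaf_chain D F G H : good_leaf D F ->
  G \in facets D -> H \in facets D -> G != F -> H != F ->
  (G :&: F \subset H :&: F)%SET \/ (H :&: F \subset G :&: F)%SET.
Proof.
move=> [[DF _] goodF] DG DH nGF nHF.
have sD : [set F; G; H]%SET \subset facets D.
  by apply/fintype.subsetP => A; rewrite !(finset.in_setU, finset.in_set1) -orbA => /or3P[]/eqP->.
have [D' facetsD'] := facets_generate sD.
have := goodF D'; rewrite facetsD' => /(_ sD).
rewrite !(finset.in_setU, finset.in_set1) eqxx => /(_ isT)[_ []].
  rewrite facetsD' => /setP/(_ G); rewrite !(finset.in_setU, finset.in_set1) eqxx orbT.
  by rewrite (negbTE nGF).
case=> A []; rewrite facetsD' !(finset.in_setU, finset.in_set1) -orbA => /or3P[]/eqP-> nAF leafA.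
- by rewrite eqxx in nAF.
- by right; apply: leafA; rewrite // !(finset.in_setU, finset.in_set1) eqxx !orbT.
- by left; apply: leafA; rewrite // !(finset.in_setU, finset.in_set1) eqxx !orbT.
Qed.

(** The other facets meet [F] inside [G :&: F], and [F] has a vertex outside
    [G] by maximality. *)
Lemma leaf_free_vertex D F : F != finset.set0 -> leaf D F ->
  exists2 v, v \in F & forall G, G \in facets D -> G != F -> v \notin G.
Proof.
move=> /set0Pn[v Fv] [DF [facetsD|[G [DG nGF leafG]]]].
  by exists v => // G; rewrite facetsD finset.in_set1 => ->.
have : ~~ (F \subset G).
  by apply: contraNN nGF => /(facet_maximal DF DG)->.
move=> /subsetPn[w Fw nGw]; exists w => // H DH nHF; apply: contra nGw => Hw.
have /fintype.subsetP/(_ w) := leafG _ DH nHF.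
by rewrite !inE Hw Fw /= andbT; apply.
Qed.

(** * Covers and their decompositions *)

Lemma sum_mnmD a b G :
  \sum_(i in G) (a + b)%MM i = (\sum_(i in G) a i + \sum_(i in G) b i)%N.
Proof. by rewrite -big_split; apply: eq_bigr => i _; rewrite mnmDE. Qed.

Lemma sum_mnm1 v G : \sum_(i in G) U_(v)%MM i = (v \in G).
Proof.
case: (boolP (v \in G)) => Gv; last first.
  by rewrite big1 // => i Gi; rewrite mnm1E; case: eqP => // vi; rewrite vi Gi in Gv.
rewrite (bigD1 v) //= mnm1E eqxx big1 ?addn0 // => i /andP[_ ne].
by rewrite mnm1E eq_sym (negbTE ne).
Qed.

Lemma kcoverD D i j a b :
  kcover D i a -> kcover D j b -> kcover D (i + j) (a + b)%MM.
Proof. by move=> ca cb G DG; rewrite sum_mnmD leq_add ?ca ?cb. Qed.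

Lemma kcover0 D c : kcover D 0 c. Proof. by []. Qed.

Definition indecomposable_cover D k c :=
  kcover D k c /\
  forall i j a b, kcover D i a -> kcover D j b ->
    (i + j)%N = k -> (a + b)%MM = c -> i = 0%N \/ j = 0%N.

(** The degrees in which the quotient of the irrelevant ideal of the cover
    algebra by its square does not vanish. *)
Definition generator_degree D k := (0 < k)%N /\ exists c, indecomposable_cover D k c.

Lemma decompose_cover D k c : ~ generator_degree D k -> (0 < k)%N -> kcover D k c ->
  exists i j a b, [/\ kcover D i a, kcover D j b, (i + j)%N = k, (a + b)%MM = c
    & (0 < i)%N && (0 < j)%N].
Proof.
move=> nk k0 ck; apply: contrapT => nex; apply: nk; split=> //; exists c; split=> //.
move=> [|i] [|j] a b ca cb eqk eqc; [by left|by left|by right|].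
by case: nex; exists i.+1, j.+1, a, b.
Qed.

(** * Removing a good leaf *)

Section RemoveLeaf.
Variables (Delta Gamma : simplicial_complex n) (F : {set 'I_n}).
Hypothesis goodF : good_leaf Delta F.
Hypothesis facets_Gamma : facets Gamma = (facets Delta :\ F)%SET.

Lemma kcover_leafP k c :
  kcover Delta k c <-> kcover Gamma k c /\ (k <= \sum_(i in F) c i)%N.
Proof.
have [[DF _] _] := goodF; split=> [cc|[cc cF] G DG].
  split; last exact: cc.
  by move=> G; rewrite facets_Gamma finset.in_setD1 => /andP[_]; apply: cc.
have [->//|nGF] := eqVneq G F.
by apply: cc; rewrite facets_Gamma finset.in_setD1 nGF.
Qed.

(** Excess weight on [F] yields a vertex of [F] where the cover can be lowered.
    It is chosen in the support of [b] so as to lie in the fewest facets: by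
    the chain property a facet through it contains all of the support of [b] in
    [F], and therefore carries at least the weight of [F]. *)
Lemma transfer_vertex j b : kcover Gamma j b -> (j < \sum_(i in F) b i)%N ->
  exists v b', [/\ v \in F, b = (U_(v) + b')%MM & kcover Gamma j b'].
Proof.
move=> cb jb.
have [v0 /andP[Fv0 bv0]] : exists v, (v \in F) && (0 < b v)%N.
  apply/existsP; apply: contraTT jb => /existsPn nb.
  rewrite big1 // => i Fi; have := nb i; rewrite Fi /= lt0n negbK; exact/eqP.
pose inc (v : 'I_n) := [set G in facets Gamma | v \in G]%SET.
have incE v G : (G \in inc v) = (G \in facets Gamma) && (v \in G).
  by rewrite finset.in_set.
case: (arg_minnP (fun v => #|inc v|) (P := fun v => (v \in F) && (0 < b v)%N)
  (i0 := v0) (introT andP (conj Fv0 bv0))) => v /andP[Fv bv] minv.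
have bE : b = (U_(v) + (b - U_(v)))%MM.
  by rewrite addmC submK // lep1mP -lt0n.
exists v, (b - U_(v))%MM; split=> // G GG.
have := cb _ GG; rewrite {1}bE sum_mnmD sum_mnm1.
have [Gv _|//] := boolP (v \in G).
(* A support vertex of F outside G would lie in strictly fewer facets than v. *)
have jG : (j < \sum_(i in G) b i)%N.
  apply: leq_trans jb _; rewrite (big_setID G) /= [X in (_ + X)%N]big1 ?addn0.
    by rewrite [leqRHS](big_setID F) /= finset.setIC leq_addr.
  move=> w; rewrite inE => /andP[nGw Fw]; apply/eqP; rewrite eqn0Ngt.
  apply/negP => bw; have := minv w; rewrite Fw bw => /(_ isT); apply/negP.
  rewrite -ltnNge; apply: proper_card; apply/properP; split; last first.
    by exists G; rewrite incE GG ?Gv // (negbTE nGw).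
  apply/fintype.subsetP => H; rewrite !incE => /andP[GH Hw]; rewrite GH /=.
  move: GG GH; rewrite facets_Gamma !finset.in_setD1 => /andP[nGF DG] /andP[nHF DH].
  case: (good_leaf_chain goodF DG DH nGF nHF) => /fintype.subsetP.
    by move=> /(_ v); rewrite !inE Gv Fv => /(_ isT)/andP[].
  by move=> /(_ w); rewrite !inE Hw Fw (negbTE nGw) => /(_ isT).
by move: jG; rewrite {1}bE sum_mnmD sum_mnm1 Gv.
Qed.

(** Each transfer of one unit along [F] from [b] to [a] lowers the deficit of
    [a] by one; while a deficit remains, [b] has an excess because the total
    weight on [F] is at least [i + j]. *)
Lemma rebalance_one i j a b :
  kcover Gamma i a -> kcover Gamma j b -> (j <= \sum_(l in F) b l)%N ->
  (i + j <= \sum_(l in F) (a + b)%MM l)%N ->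
  exists a' b', [/\ kcover Delta i a', kcover Delta j b' & (a' + b' = a + b)%MM].
Proof.
move: {2}(i - \sum_(l in F) a l)%N (leqnn (i - \sum_(l in F) a l)%N) => m.
elim: m a b => [|m IH] a b; rewrite sum_mnmD.
  rewrite leqn0 subn_eq0 => ia ca cb jb _; exists a, b.
  by split=> //; apply/kcover_leafP.
have [ia _ ca cb jb _|ai im ca cb jb ijab] := leqP i (\sum_(l in F) a l).
  by exists a, b; split=> //; apply/kcover_leafP.
have jb' : (j < \sum_(l in F) b l)%N.
  rewrite -(ltn_add2l i); apply: leq_ltn_trans ijab _; by rewrite ltn_add2r.
have [v [b' [Fv bE cb']]] := transfer_vertex cb jb'.
have abE : (a + b = (a + U_(v)) + b')%MM by rewrite bE addmA.
have [|||||a' [b'' [? ? eqab]]] := IH (a + U_(v))%MM b'.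
- by rewrite sum_mnmD sum_mnm1 Fv addn1 subnS; case: (i - _)%N im.
- by move=> G GG; rewrite sum_mnmD (leq_trans (ca _ GG)) ?leq_addr.
- exact: cb'.
- by move: jb'; rewrite bE sum_mnmD sum_mnm1 Fv.
- by rewrite -abE sum_mnmD.
by exists a', b''; rewrite abE.
Qed.

(** Both summands cannot fall short on [F], so [rebalance_one] applies to them
    in one of the two orders. *)
Lemma rebalance i j a b :
  kcover Gamma i a -> kcover Gamma j b -> kcover Delta (i + j) (a + b)%MM ->
  exists a' b', [/\ kcover Delta i a', kcover Delta j b' & (a' + b' = a + b)%MM].
Proof.
move=> ca cb /kcover_leafP[_ cF].
have [jb|bj] := leqP j (\sum_(l in F) b l); first exact: rebalance_one.
have ia : (i <= \sum_(l in F) a l)%N.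
  rewrite leqNgt; apply/negP => ai; move: cF; rewrite sum_mnmD leqNgt.
  by rewrite -addSn leq_add // ltnW.
have [|b' [a' [? ? eqab]]] := rebalance_one cb ca ia; first by rewrite addnC addmC.
by exists a', b'; split=> //; rewrite addmC eqab addmC.
Qed.

(** From [Delta] to [Gamma] the same cover remains indecomposable, by
    [rebalance]; from [Gamma] to [Delta] it is first increased at a free vertex
    of [F]. *)
Lemma generator_degree_remove_leaf k : F != finset.set0 ->
  generator_degree Delta k <-> generator_degree Gamma k.
Proof.
move=> F0; split=> -[k0 [c [cc indc]]]; split=> //.
  exists c; split; first by have /kcover_leafP[] := cc.
  move=> i j a b ca cb ijk abc; rewrite -ijk -abc in cc.
  have [a' [b' [ca' cb' eqab]]] := rebalance ca cb cc.
  by apply: indc ca' cb' ijk _; rewrite eqab.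
have [v Fv freev] := leaf_free_vertex F0 (proj1 goodF).
have neqv G l : G \in facets Gamma -> l \in G -> l != v.
  rewrite facets_Gamma finset.in_setD1 => /andP[nGF DG] Gl.
  by apply: contraNneq (freev _ DG nGF) => <-.
exists (c + U_(v) *+ k)%MM; split.
  apply/kcover_leafP; split=> [G GG|].
    by rewrite sum_mnmD (leq_trans (cc _ GG)) ?leq_addr.
  rewrite (bigD1 v) //= mnmDE mulmnE mnm1E eqxx mul1n.
  by rewrite addnAC leq_addl.
move=> i j a b /kcover_leafP[ca _] /kcover_leafP[cb _] ijk abc.
(* No facet of Gamma contains v, so the values there can be chosen freely to
   make the sum equal to c. *)
pose a' := [multinom if l == v then c v else a l | l < n].
pose b' := [multinom if l == v then 0%N else b l | l < n].
apply: (indc i j a' b') => //.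
- move=> G GG; rewrite (leq_trans (ca _ GG)) // leq_eqVlt; apply/orP; left.
  by apply/eqP/eq_bigr => l Gl; rewrite mnmE (negbTE (neqv _ _ GG Gl)).
- move=> G GG; rewrite (leq_trans (cb _ GG)) // leq_eqVlt; apply/orP; left.
  by apply/eqP/eq_bigr => l Gl; rewrite mnmE (negbTE (neqv _ _ GG Gl)).
apply/mnmP => l; rewrite mnmDE !mnmE; case: eqP => [->|/eqP nlv].
  by rewrite addn0.
have /mnmP/(_ l) := abc; rewrite !mnmDE mulmnE mnm1E eq_sym (negbTE nlv).
by rewrite mul0n addn0.
Qed.

End RemoveLeaf.
End Complexes.

(** * Generators of the cover algebra *)

Section Algebra.
Local Open Scope ring_scope.
Local Open Scope classical_set_scope.
Variables (K : fieldType) (n : nat).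
Local Notation S := {mpoly K[n]}.
Implicit Types (D : simplicial_complex n) (f g h : {poly S}) (G : set {poly S})
  (Q : nat -> 'X_{1..n} -> Prop) (a b c : 'X_{1..n}).

Definition monomial k c : {poly S} := ('X_[c] : S) *: 'X^k.

Definition supported Q : set {poly S} :=
  [set f | forall k c, (f`_k)@_c != 0 -> Q k c].

Lemma coef_monomial j k b c :
  ((monomial k c)`_j)@_b = ((j == k) && (b == c))%:R :> K.
Proof.
rewrite coefZ coefXn mulr_natr mcoeffMn mcoeffX eq_sym.
by case: (j == k); rewrite ?mulr1n ?mulr0n.
Qed.

Lemma monomialD i j a b :
  monomial (i + j) (a + b)%MM = monomial i a * monomial j b.
Proof. by rewrite /monomial mpolyXD exprD -scalerAl -scalerAr scalerA. Qed.

Lemma tdegree_homogeneous (p : S) k : p != 0 -> tdegree (p *: 'X^k) = k.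
Proof.
by move=> p0; rewrite /tdegree -mul_polyC size_Cmul // size_polyXn.
Qed.

Lemma monomial_supported Q k c : supported Q (monomial k c) <-> Q k c.
Proof.
split=> [|Qkc j b]; first by apply; rewrite coef_monomial !eqxx oner_neq0.
by rewrite coef_monomial; case: andP => [[/eqP-> /eqP->]|]; rewrite ?eqxx.
Qed.

Lemma cover_algebraE D : cover_algebra K n D = supported (kcover D).
Proof.
apply/seteqP; split=> f Af k => [c|].
  have [s [a [sk]]] := Af k.
  move=> /(congr1 (fun h : {poly S} => h`_k)).
  rewrite coefZ coefXn eqxx mulr1 => ->.
  apply: contraNP => nc; rewrite coef_sum raddf_sum /= big_seq big1 // => b sb.
  rewrite coefZ coefXn eqxx mulr1 mcoeffZ mcoeffX.
  by have [bc|] := eqVneq b c; [case: nc; rewrite -bc; apply: sk|rewrite mulr0].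
exists (msupp f`_k), (fun c => (f`_k)@_c); split.
  by move=> c; rewrite mcoeff_msupp => /Af.
by rewrite {1}[f`_k]mpolyE scaler_suml.
Qed.

Lemma subalgebra_sum G I (r : seq I) (P : pred I) (E : I -> {poly S}) :
  (forall i, P i -> subalgebra G (E i)) -> subalgebra G (\sum_(i <- r | P i) E i).
Proof.
move=> GE; apply: (big_ind (subalgebra G)) => //.
  by rewrite -polyC0; apply: subalgebra_const.
by move=> f g; apply: subalgebra_add.
Qed.

Lemma subalgebra_sub G G' : G `<=` subalgebra G' -> subalgebra G `<=` subalgebra G'.
Proof.
move=> GG' f; elim=> [|p|g h _ Gg _ Gh|g h _ Gg _ Gh].
- exact: GG'.
- exact: subalgebra_const.
- exact: subalgebra_add.
- exact: subalgebra_mul.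
Qed.

(** Products of monomials with exponents in a monoid [Q] stay in [Q]; the
    coefficients of the base ring require [Q] to hold in degree zero. *)
Lemma subalgebra_supported Q G :
  (forall c, Q 0%N c) ->
  (forall i j a b, Q i a -> Q j b -> Q (i + j)%N (a + b)%MM) ->
  G `<=` supported Q -> subalgebra G `<=` supported Q.
Proof.
move=> Q0 QD GQ f; elim=> [|p|g h _ Gg _ Gh|g h _ Gg _ Gh] => [|k c|k c|k c].
- exact: GQ.
- by rewrite coefC; have [->|_] := eqVneq k 0%N; rewrite // mcoeff0 eqxx.
- rewrite coefD mcoeffD; have [->|/Gg//] := eqVneq (g`_k)@_c 0.
  by rewrite add0r => /Gh.
apply: contraNP => nQ; rewrite coefM raddf_sum big1 //= => i _.
rewrite mcoeffM big1 // => -[/= a b] /eqP abc; apply/eqP; rewrite mulf_eq0.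
apply/norP => -[/Gg Qg /Gh Qh]; apply: nQ.
have <- : (i + (k - i) = k)%N by rewrite subnKC // -ltnS.
by rewrite abc; apply: QD.
Qed.

Lemma supported_subalgebra Q G :
  (forall k c, Q k c -> subalgebra G (monomial k c)) -> supported Q `<=` subalgebra G.
Proof.
move=> monomialG f fQ; rewrite -[f]coefK poly_def; apply: subalgebra_sum => k _.
rewrite [X in X *: _]mpolyE scaler_suml big_seq.
apply: subalgebra_sum => c; rewrite mcoeff_msupp => /fQ Qkc.
have -> : ((f`_k)@_c *: 'X_[c]) *: 'X^k = (((f`_k)@_c)%:MP)%:P * monomial k c.
  by rewrite mul_polyC scalerA mul_mpolyC.
by apply: subalgebra_mul; [apply: subalgebra_const|apply: monomialG].
Qed.

(** The degree [k] part of a polynomial expression in homogeneous generators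
    involves only the generators of degree at most [k]. *)
Lemma subalgebra_homogeneous_component G f k :
  (forall g, G g -> homogeneous g) -> subalgebra G f ->
  subalgebra (G `&` [set g | (tdegree g <= k)%N]) (f`_k *: 'X^k).
Proof.
move=> homG Gf; elim: Gf k => [g Gg|p|g h _ Gg _ Gh|g h _ Gg _ Gh] k.
- have [p [j gE]] := homG _ Gg.
  have [->|/negbTE kj] := eqVneq (g`_k) 0.
    by rewrite scale0r -polyC0; apply: subalgebra_const.
  move: kj; rewrite {1}gE coefZ coefXn; have [->|] := eqVneq k j; last first.
    by rewrite mulr0 eqxx.
  rewrite mulr1 => p0; rewrite {1}gE coefZ coefXn eqxx mulr1 -gE.
  by apply: subalgebra_gen; split=> //=; rewrite gE tdegree_homogeneous ?p0.
- rewrite coefC; case: eqP => [->|_].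
    by rewrite expr0 alg_polyC; apply: subalgebra_const.
  by rewrite scale0r -polyC0; apply: subalgebra_const.
- by rewrite coefD scalerDl; apply: subalgebra_add.
rewrite coefM scaler_suml; apply: subalgebra_sum => i _.
have ik : (i <= k)%N by rewrite -ltnS.
have -> : (g`_i * h`_(k - i)) *: 'X^k = (g`_i *: 'X^i) * (h`_(k - i) *: 'X^(k - i)).
  by rewrite -scalerAl -scalerAr scalerA -exprD subnKC.
have sub j : (j <= k)%N -> subalgebra (G `&` [set g | (tdegree g <= j)%N])
    `<=` subalgebra (G `&` [set g | (tdegree g <= k)%N]).
  move=> jk; apply: subalgebra_sub => e [Ge /= ej].
  by apply: subalgebra_gen; split=> //=; apply: leq_trans jk.
by apply: subalgebra_mul; [apply: sub ik _ (Gg i)|apply: sub (Gh (k - i)%N); rewrite leq_subr].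
Qed.

Lemma subalgebra_cover_algebra D G :
  G `<=` cover_algebra K n D -> subalgebra G `<=` cover_algebra K n D.
Proof.
rewrite cover_algebraE; apply: subalgebra_supported; first exact: kcover0.
exact: kcoverD.
Qed.

(** Discarding the indecomposable [k]-covers from the monoid of covers leaves a
    monoid, because a sum of covers that is an indecomposable [k]-cover has one
    summand of degree zero and the other again indecomposable.  If no generator
    had degree [k], the whole algebra would be supported on that monoid. *)
Lemma generator_degree_in_generators D G k :
  (forall g, G g -> homogeneous g) -> subalgebra G = cover_algebra K n D ->
  generator_degree D k -> exists2 g, G g & tdegree g = k.
Proof.
move=> homG GA [k0 [c [cc indc]]]; apply: contrapT => nG.
pose Q j b := kcover D j b /\ (j = k -> ~ indecomposable_cover D k b).
suff /(_ (monomial k c)) : subalgebra G `<=` supported Q.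
  rewrite GA cover_algebraE => /(_ _)/monomial_supported[].
    exact/monomial_supported.
  by move=> _ /(_ erefl); apply.
apply: subalgebra_supported => [b|i j a b [ca na] [cb nb]|g Gg].
- by split; [exact: kcover0|move=> E; rewrite -E in k0].
- split; [exact: kcoverD|move=> ijk [cab indab]].
  have [i0|j0] := indab i j a b ca cb ijk erefl.
  + apply: nb; first by rewrite -ijk i0.
    have jk : j = k by rewrite -ijk i0.
    split; first by rewrite -jk.
    move=> i' j' a' b' ca' cb' ij' ab'.
    apply: (indab i' j' (a + a')%MM b') => //; last by rewrite -ab' addmA.
    by rewrite -[i']add0n; apply: kcoverD.
  + have ik : i = k by rewrite -ijk j0 addn0.
    apply: na => //; split; first by rewrite -ik.
    move=> i' j' a' b' ca' cb' ij' ab'.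
    apply: (indab i' j' a' (b' + b)%MM) => //; last by rewrite -ab' addmA.
    by rewrite -[j']addn0; apply: kcoverD.
have : cover_algebra K n D g by rewrite -GA; apply: subalgebra_gen.
rewrite cover_algebraE => Ag j b gb; split; first exact: Ag.
move=> jk; case: nG; exists g => //; have [p [i gE]] := homG _ Gg.
move: gb; rewrite gE coefZ coefXn -jk.
have [->|] := eqVneq j i; last by rewrite mulr0 mcoeff0 eqxx.
rewrite mulr1 => pb; rewrite tdegree_homogeneous //.
by apply: contraNneq pb => ->; rewrite mcoeff0.
Qed.

(** If the degree of [g] is not a generator degree, all monomials of [g] are
    products of monomials of lower degree; these are generated without [g], so
    [g] is redundant. *)
Lemma minimal_generator_degree D G g :
  minimal_homogeneous_generators (cover_algebra K n D) G ->
  G g -> generator_degree D (tdegree g).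
Proof.
move=> [homG GA minG] Gg; apply: contrapT => ngen.
suff G'g : subalgebra (G `\ g) g.
  have G'A : subalgebra (G `\ g) = cover_algebra K n D.
    rewrite -GA; apply/seteqP; split; apply: subalgebra_sub => h.
      by case=> Gh _; apply: subalgebra_gen.
    by move=> Gh; have [->//|/eqP nhg] := eqVneq h g; apply: subalgebra_gen.
  have G'G := minG _ (@subDsetl _ _ _) G'A.
  by move: Gg; rewrite -G'G => -[_ /=].
have Ag : cover_algebra K n D g by rewrite -GA; apply: subalgebra_gen.
have [p [k gE]] := homG _ Gg.
have [p0|p0] := eqVneq p 0.
  by rewrite {2}gE p0 scale0r -polyC0; apply: subalgebra_const.
have gk : tdegree g = k by rewrite gE tdegree_homogeneous.
have [k0|k0] := posnP k.
  by rewrite {2}gE k0 expr0 alg_polyC; apply: subalgebra_const.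
rewrite gk in ngen.
(* Monomials of degree less than k only need generators of smaller degree. *)
have low j b : (j < k)%N -> kcover D j b -> subalgebra (G `\ g) (monomial j b).
  move=> jk cb; have : subalgebra G (monomial j b).
    by rewrite GA cover_algebraE; apply/monomial_supported.
  move=> /(subalgebra_homogeneous_component j homG).
  rewrite coefZ coefXn eqxx mulr1; apply: subalgebra_sub => h [Gh /= hj].
  apply: subalgebra_gen; split=> //= hg.
  by move: hj; rewrite hg gk leqNgt jk.
pose Q j b := j = k /\ kcover D j b.
apply: (@supported_subalgebra Q) => [_ c [-> cc]|j b gb].
  have [i [j [a [b [ca cb ijk abc /andP[i0 j0]]]]]] := decompose_cover ngen k0 cc.
  rewrite -ijk -abc monomialD.
  apply: subalgebra_mul; apply: low => //; rewrite -ijk.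
    by rewrite -[X in (X < _)%N]addn0 ltn_add2l.
  by rewrite -[X in (X < _)%N]add0n ltn_add2r.
split; last by move: Ag; rewrite cover_algebraE; apply.
apply/eqP; apply: contraNT gb => /negbTE jk.
by rewrite gE coefZ coefXn jk mulr0 mcoeff0.
Qed.

(** Irreducible elements of positive degree in the monoid of pairs of a degree
    and a cover.  In contrast to [indecomposable_cover], splitting off a nonzero
    summand of degree zero is excluded as well, since multiples of a generator
    by a monomial of the base ring are redundant. *)
Definition irreducible_cover D k c := [/\ (0 < k)%N, kcover D k c &
  forall i j a b, kcover D i a -> kcover D j b -> (i + j)%N = k -> (a + b)%MM = c ->
    (i = 0%N /\ a = 0%MM) \/ (j = 0%N /\ b = 0%MM)].

Definition irreducible_monomials D : set {poly S} :=
  [set f | exists k c, irreducible_cover D k c /\ f = monomial k c].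

(** Splitting a reducible exponent strictly lowers [k + mdeg c]. *)
Lemma irreducible_monomials_generate D k c :
  kcover D k c -> subalgebra (irreducible_monomials D) (monomial k c).
Proof.
have [m] := ubnP (k + mdeg c)%N; elim: m => // m IH in k c *.
rewrite ltnS => km cc.
have [->|k0] := posnP k.
  by rewrite /monomial expr0 alg_polyC; apply: subalgebra_const.
have [irr|nirr] := pselect (irreducible_cover D k c).
  by apply: subalgebra_gen; exists k, c.
apply: contrapT => nsub; apply: nirr; split=> // i j a b ca cb ijk abc.
have size0 l e : (l + mdeg e = 0)%N -> l = 0%N /\ e = 0%MM.
  by move=> /eqP; rewrite addn_eq0 => /andP[/eqP-> ]; rewrite mdeg_eq0 => /eqP.
have sumE : (k + mdeg c = (i + mdeg a) + (j + mdeg b))%N.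
  by rewrite -ijk -abc mdegD addnACA.
have [/size0|a0] := posnP (i + mdeg a)%N; first by left.
have [/size0|b0] := posnP (j + mdeg b)%N; first by right.
case: nsub; rewrite -ijk -abc monomialD.
rewrite sumE in km.
apply: subalgebra_mul; apply: IH => //; apply: leq_trans km.
  by rewrite -[X in (X < _)%N]addn0 ltn_add2l.
by rewrite -[X in (X < _)%N]add0n ltn_add2r.
Qed.

(** Removing one irreducible element from the monoid of covers leaves a monoid,
    so its monomial is not generated by the others. *)
Lemma irreducible_monomials_minimal D :
  minimal_homogeneous_generators (cover_algebra K n D) (irreducible_monomials D).
Proof.
split.
- by move=> _ [k [c [_ ->]]]; exists 'X_[c], k.
- apply/seteqP; split; last first.
    rewrite cover_algebraE; apply: supported_subalgebra.
    exact: irreducible_monomials_generate.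
  apply: subalgebra_cover_algebra => _ [k [c [[_ cc _] ->]]].
  by rewrite cover_algebraE; apply/monomial_supported.
move=> G' sG' G'A; apply/seteqP; split=> // _ [k [c [irr ->]]].
have [k0 cc irrc] := irr; apply: contrapT => nG'.
pose Q j b := kcover D j b /\ ~ (j = k /\ b = c).
suff /(_ (monomial k c)) : subalgebra G' `<=` supported Q.
  rewrite G'A cover_algebraE => /(_ _)/monomial_supported[].
    exact/monomial_supported.
  by move=> _ /(_ (conj erefl erefl)).
apply: subalgebra_supported => [b|i j a b [ca na] [cb nb]|g G'g].
- by split; [exact: kcover0|case=> E; rewrite -E in k0].
- split; [exact: kcoverD|case=> ijk abc].
  have [[i0 a0]|[j0 b0]] := irrc i j a b ca cb ijk abc.
    by apply: nb; rewrite -ijk -abc i0 a0 add0n add0m.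
  by apply: na; rewrite -ijk -abc j0 b0 addn0 addm0.
have [j [b [[_ cb _] gE]]] := sG' _ G'g.
rewrite gE; apply/monomial_supported; split=> // -[jk bc].
by apply: nG'; rewrite -jk -bc -gE.
Qed.

(** The minimal generating sets disappear from the definition: all of them have
    the generator degrees as degrees, and one of them exists.  The default value
    is covered too, because the two sets defining the degree are equal. *)
Lemma max_generator_degreeE D :
  max_generator_degree (cover_algebra K n D) =
  xget 0%N [set d | generator_degree D d /\
                    forall k, generator_degree D k -> (k <= d)%N].
Proof.
rewrite /max_generator_degree; congr xget; apply/seteqP; split=> d /=.
  case=> G [minG [g Gg <-] Gd]; split; first exact: minimal_generator_degree minG Gg.
  have [homG GA _] := minG.
  by move=> k /(generator_degree_in_generators homG GA)[e Ge <-]; apply: Gd.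
case=> gend maxd; exists (irreducible_monomials D).
have minD := irreducible_monomials_minimal D; split=> //.
  by have [homD DA _] := minD; apply: generator_degree_in_generators DA gend.
by move=> g /(minimal_generator_degree minD)/maxd.
Qed.

End Algebra.

Theorem theorem3p6 (K : fieldType) (n : nat)
  (Delta Gamma : simplicial_complex n)
  (F : {set 'I_n})
  (facets_neq0 : forall G : {set 'I_n}, G \in facets Delta -> G != finset.set0)
  (goodF : good_leaf Delta F)
  (facets_Gamma : facets Gamma = (facets Delta :\ F)%SET) :
  max_generator_degree (cover_algebra K n Delta) =
  max_generator_degree (cover_algebra K n Gamma).
Proof.
have [[DF _] _] := goodF.
rewrite !max_generator_degreeE; congr xget.
have genE k := generator_degree_remove_leaf goodF facets_Gamma k (facets_neq0 _ DF).
apply/seteqP; split=> d [gend maxd]; split=> [|k genk].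
- exact/genE.
- by apply: maxd; apply/genE.
- exact/genE.
- by apply: maxd; apply/genE.
Qed.
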